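(* Let $p\ge r>0$ be positive integers and let $q,s\in\mathbb{Z}$. If the twisted torus link $T(p,q;r,s)$ is a knot (i.e. has exactly one component), then $\gcd(p,q,r,s)=1$.
   Context: For positive integers $p\ge r>0$ and integers $q,s$, the twisted torus link $T(p,q;r,s)$ is the closure of the braid on $p$ strands $(\sigma_1\sigma_2\cdots\sigma_{p-1})^q(\sigma_1\cdots\sigma_{r-1})^s$, where $\sigma_1,\dots,\sigma_{p-1}$ are the standard generators of the braid group on $p$ strands (an empty product is the trivial braid). *)

(* Defs.v *)
From HB Require Import structures.
From mathcomp Require Import all_boot all_order all_algebra.
From mathcomp Require Import all_classical all_reals all_analysis.
Set Implicit Arguments.
Unset Strict Implicit.
Unset Printing Implicit Defensive.
Import Order.TTheory GRing.Theory Num.Theory.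
Import numFieldNormedType.Exports.
Local Open Scope classical_set_scope.
Local Open Scope ring_scope.

(* A braid on p strands is given by a word in the standard generators: with
   strands at positions 0, ..., p - 1, the letter (i, true) is sigma_(i+1),
   which crosses the strands at positions i and i + 1, and (i, false) is its
   inverse.  'I_p.-1 is empty for p <= 1. *)
Definition braid_word (p : nat) := seq ('I_p.-1 * bool).

Definition braid_inv (p : nat) (w : braid_word p) : braid_word p :=
  rev [seq (a.1, ~~ a.2) | a <- w].

Definition braid_exp (p : nat) (w : braid_word p) (m : int) : braid_word p :=
  match m with
  | Posz n => flatten (nseq n w)
  | Negz n => flatten (nseq n.+1 (braid_inv w))
  end.

(* sigma_1 sigma_2 ... sigma_(r-1) in the braid group on p >= r strands. *)
Definition sigma_prod (p r : nat) : braid_word p :=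
  [seq (i, true) | i : 'I_p.-1 <- enum 'I_p.-1 & (i < r.-1)%N].

Definition twisted_torus_braid (p : nat) (q : int) (r : nat) (s : int) :
    braid_word p :=
  braid_exp (sigma_prod p p) q ++ braid_exp (sigma_prod p r) s.

(* Geometric realization in R^3.  Braids run upwards in the z direction, the
   first letter at the bottom, and the diagram is the projection to the
   (x, z)-plane seen from y = -oo (so that x points to the right): a smaller y
   is closer to the viewer. *)
Section Closure.
Variable R : realType.

(* The strand of the letter a that starts at position j, at time t in [0, 1],
   drawn from height k.  In sigma_(i+1) the strand going from i to i + 1 passes
   over the one going from i + 1 to i. *)
Definition letter_strand (p : nat) (a : 'I_p.-1 * bool) (k j : nat) (t : R) :
    R * R * R :=
  let y := (if a.2 then - 1 else 1) * (t * (1 - t)) in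
  if j == a.1 :> nat then (j%:R + t, y, k%:R + t)
  else if j == a.1.+1 then (j%:R - t, - y, k%:R + t)
  else (j%:R, 0, k%:R + t).

Definition letter_set (p : nat) (a : 'I_p.-1 * bool) (k : nat) :
    set (R * R * R) :=
  \bigcup_(j in `I_p) (letter_strand a k j @` `[0, 1]).

(* The word w, drawn between the heights k and k + size w. *)
Fixpoint word_set (p k : nat) (w : braid_word p) : set (R * R * R) :=
  if w is a :: w' then letter_set a k `|` word_set k.+1 w' else set0.

(* The polygonal arc in the plane y = 0 that joins the top end (j, 0, n) of the
   position j to its bottom end (j, 0, 0) by going around the right of the
   braid; the arcs for different j are nested, hence pairwise disjoint. *)
Definition closing_arc (p n j : nat) : set (R * R * R) :=
  let c : R := (p - j)%:R in
  let x0 : R := j%:R in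
  let x1 : R := p%:R + c in
  let z0 : R := - c in
  let z1 : R := n%:R + c in
  [set (x0, 0, z) | z in `[n%:R, z1]] `|`
  [set (x, 0, z1) | x in `[x0, x1]] `|`
  [set (x1, 0, z) | z in `[z0, z1]] `|`
  [set (x, 0, z0) | x in `[x0, x1]] `|`
  [set (x0, 0, z) | z in `[z0, 0]].

Definition braid_closure (p : nat) (w : braid_word p) : set (R * R * R) :=
  word_set 0 w `|` \bigcup_(j in `I_p) closing_arc p (size w) j.

Definition twisted_torus_link (p : nat) (q : int) (r : nat) (s : int) :
    set (R * R * R) :=
  braid_closure (twisted_torus_braid p q r s).

Definition components (L : set (R * R * R)) : set (set (R * R * R)) :=
  [set connected_component L x | x in L].

(* To be applied to links, for which having exactly one component means being
   a knot. *)
Definition is_knot (L : set (R * R * R)) : Prop :=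
  exists C, components L = [set C].

End Closure.

Arguments twisted_torus_link R p q r s : clear implicits.

(* Main.v *)
(* If d divides p, q, r and s, the permutation underlying the braid preserves
   residues modulo d of the positions: the two factors act by cycles that shift
   positions by 1 modulo p and modulo r, and their q-th and s-th powers shift
   by multiples of d.
   If d > 1, the strands and closing arcs in residue class 0 and the others
   then form two disjoint nonempty closed sets that cover the link, which is
   therefore disconnected. *)
Require Import Defs.
From mathcomp Require Import all_boot all_order all_algebra.
From mathcomp Require Import all_classical all_reals all_analysis.
From mathcomp Require Import zify ring lra.
Set Implicit Arguments.
Unset Strict Implicit.
Unset Printing Implicit Defensive.
Import Order.TTheory GRing.Theory Num.Theory.
Import numFieldNormedType.Exports.
Local Open Scope classical_set_scope.
Local Open Scope ring_scope.

(** * The permutation of positions underlying a braid word *)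

Definition swap (i j : nat) : nat :=
  if j == i then i.+1 else if j == i.+1 then i else j.

Lemma swapK i : involutive (swap i).
Proof. by move=> j; rewrite /swap; do ![case: ifP => /=]; lia. Qed.

(* The strand that ends at position j above w starts at position
   [word_perm w j] below it. *)
Definition word_perm p (w : braid_word p) (j : nat) : nat :=
  foldr (fun a => swap (nat_of_ord a.1)) j w.

Lemma word_perm_cat p (v w : braid_word p) j :
  word_perm (v ++ w) j = word_perm v (word_perm w j).
Proof. exact: foldr_cat. Qed.

Lemma word_perm_inv p (w : braid_word p) :
  cancel (word_perm (braid_inv w)) (word_perm w).
Proof.
elim: w => [//|a w IH] j.
by rewrite /braid_inv map_cons rev_cons -cats1 word_perm_cat /= IH swapK.
Qed.

Lemma word_perm_nseq p (w : braid_word p) n j :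
  word_perm (flatten (nseq n w)) j = iter n (word_perm w) j.
Proof. by elim: n => //= n IH; rewrite word_perm_cat IH. Qed.

(** The swaps act from the last letter to the first: position [r - 1] is carried down to [0] by all
    of them, while [j < r - 1] is moved only by the swap of index [j]. *)
Lemma word_perm_sigma p r j : (0 < r)%N -> (r <= p)%N ->
  word_perm (sigma_prod p r) j = if (j < r)%N then (j.+1 %% r)%N else j.
Proof.
move=> r0 rp.
have -> : word_perm (sigma_prod p r) j = foldr swap j (iota 0 r.-1).
  have -> : iota 0 r.-1 =
      [seq nat_of_ord a.1 | a : 'I_p.-1 * bool <- sigma_prod p r].
    rewrite /sigma_prod -map_comp.
    rewrite -(filter_map val (fun i => i < r.-1)%N) /= val_enum_ord.
    by apply/esym/filter_iota_ltn; lia.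
  by rewrite foldr_map.
(* The induction on the length needs runs of swaps that start at an arbitrary [k]; [j = k + m] is
   the position carried all the way down. *)
have iotaE m k : foldr swap j (iota k m) =
    if (k <= j < k + m)%N then j.+1 else if j == k + m :> nat then k else j.
  elim: m k => [|m IH] k /=; first by rewrite addn0; do ![case: ifP => /=]; lia.
  by rewrite IH /swap; do ![case: ifP => /=]; lia.
rewrite iotaE add0n /=; case: ltnP => [jr|].
  rewrite (_ : (j < r)%N); last by lia.
  by rewrite modn_small //; lia.
case: eqP => [-> _|]; first by rewrite prednK // leqnn modnn.
by move=> ? ?; rewrite ltnNge (_ : (r <= j)%N)//; lia.
Qed.

(** Below [r] the iterate is [j + n] reduced modulo [r]; this reduction respects residues modulo [d]
    because [d] divides [r], and the shift [n] vanishes modulo [d]. Positions from [r] on are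
    fixed. *)
Lemma iter_sigma_mod p r d n j : (0 < r)%N -> (r <= p)%N ->
    (d %| r)%N -> (d %| n)%N ->
  iter n (word_perm (sigma_prod p r)) j = j %[mod d].
Proof.
move=> r0 rp dr dn; set f := word_perm _.
have [jr|rj] := ltnP j r; last first.
  elim: n {dn} => //= n IH; have fj : f j = j.
    by rewrite /f word_perm_sigma // ltnNge rj.
  suff -> : iter n f j = j by rewrite fj.
  by elim: n {IH} => //= n ->.
have -> : iter n f j = ((j + n) %% r)%N.
  elim: n {dn} => [|n /= ->]; first by rewrite addn0 modn_small.
  by rewrite /f word_perm_sigma // ltn_mod r0 -addn1 modnDml addn1 addnS.
by rewrite modn_dvdm // -modnDmr (eqP dn) addn0.
Qed.

Lemma word_perm_sigma_exp p r d (m : int) j : (0 < r)%N -> (r <= p)%N ->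
    (d %| r)%N -> (d %| absz m)%N ->
  word_perm (braid_exp (sigma_prod p r) m) j = j %[mod d].
Proof.
move=> r0 rp dr; case: m => n dn; rewrite /braid_exp word_perm_nseq.
  exact: iter_sigma_mod.
set f := word_perm (sigma_prod p r); set g := word_perm _.
(* A negative power iterates the inverse word; the positive power undoes it and preserves residues,
   so the negative power preserves them as well. *)
have fg : cancel (iter n.+1 g) (iter n.+1 f).
  elim: n.+1 => [//|l IH] i; rewrite iterSr (iterS l g).
  by rewrite /f /g word_perm_inv IH.
by rewrite -[in RHS](fg j) iter_sigma_mod.
Qed.

Lemma word_perm_twisted_torus p r d (q s : int) j : (0 < r)%N -> (r <= p)%N ->
    (d %| p)%N -> (d %| absz q)%N -> (d %| r)%N -> (d %| absz s)%N ->
  word_perm (twisted_torus_braid p q r s) j = j %[mod d].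
Proof.
move=> r0 rp dp dq dr ds; rewrite /twisted_torus_braid word_perm_cat.
by rewrite word_perm_sigma_exp ?(leq_trans r0 rp)// word_perm_sigma_exp.
Qed.

(** * Geometry of the strands of a single letter *)

Section Strands.
Variable R : realType.
Implicit Types (S T : set nat) (u : R * R * R).

(** Keeps a moving strand from meeting a third, vertical one. *)
Lemma nat_segment (i j : nat) (t : R) : 0 <= t <= 1 ->
  i%:R + t = j%:R -> (i <= j <= i.+1)%N.
Proof. by move=> t01 E; rewrite -!(ler_nat R) -natr1; lra. Qed.

Lemma letter_strand0 p (a : 'I_p.-1 * bool) k j :
  letter_strand a k j (0 : R) = (j%:R, 0, k%:R).
Proof.
by rewrite /letter_strand; do ![case: ifP => _]; congr (_, _, _); ring.
Qed.

Lemma letter_strand1 p (a : 'I_p.-1 * bool) k j :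
  letter_strand a k j (1 : R) = ((swap a.1 j)%:R, 0, k.+1%:R).
Proof.
rewrite /letter_strand /swap.
do ![case: eqP => [->|_]]; congr (_, _, _); rewrite -?natr1; ring.
Qed.

Lemma letter_strand_z p (a : 'I_p.-1 * bool) k j (t : R) :
  (letter_strand a k j t).2 = k%:R + t.
Proof. by rewrite /letter_strand; do ![case: ifP => _]. Qed.

Lemma letter_strand_x p (a : 'I_p.-1 * bool) k j (t : R) : (j < p)%N ->
  0 <= t <= 1 -> (letter_strand a k j t).1.1 <= p%:R.
Proof.
rewrite -(ler_nat R) -natr1 => jp t01.
by rewrite /letter_strand; do ![case: ifP => _] => /=; lra.
Qed.

(** Equal heights force equal times, so it remains to compare the strands of one letter pairwise at
    a single time [t]. *)
Lemma letter_strand_inj p (a : 'I_p.-1 * bool) k i j (t t' : R) :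
    0 <= t <= 1 -> letter_strand a k i t = letter_strand a k j t' -> i = j.
Proof.
move=> t01 E; have tt' : t = t'.
  by have := congr1 snd E; rewrite !letter_strand_z => /addrI.
subst t'; move: E; rewrite /letter_strand.
set y := _ * (t * (1 - t)).
(* The projections cross only at t = 1/2, where the depths are opposite and
   nonzero. *)
have cross (b : R) : b + t = b + 1 - t -> y <> - y.
  move=> bt; have t2 : t = 2^-1 by lra.
  by rewrite /y t2; case: ifP => _; lra.
have seg := nat_segment t01.
(* The strand moving left is at [i + 1 - t = i + (1 - t)], so the same bound serves it with time
   [1 - t]. *)
have t01' : 0 <= 1 - t <= 1 by lra.
have seg' := nat_segment t01'.
do 4?[case: eqP => [->|?]] => // -[].
- by rewrite -natr1 => /cross.
- by move=> /seg; lia.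
- by rewrite -natr1 => /esym/cross + /esym.
- by rewrite -natr1 -addrA => /seg'; lia.
- by move=> /esym/seg; lia.
- by rewrite -natr1 -addrA => /esym/seg'; lia.
- by move=> /eqP; rewrite eqr_nat => /eqP.
Qed.

(** * Strands of a word, sorted by their starting positions *)

(* The part of [word_set k w] made of the strands that start from a position
   of S at height k. *)
Fixpoint word_strands p k S (w : braid_word p) : set (R * R * R) :=
  if w is a :: w' then
    (\bigcup_(j in `I_p `&` S) (letter_strand a k j @` `[0, 1])) `|`
    word_strands k.+1 (swap a.1 @^-1` S) w'
  else set0.

Lemma word_strandsU p k S T (w : braid_word p) :
  word_strands k (S `|` T) w = word_strands k S w `|` word_strands k T w.
Proof.
elim: w k S T => [|a w IH] k S T /=; first by rewrite setU0.
by rewrite setIUr bigcup_setU preimage_setU IH setUACA.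
Qed.

Lemma word_strandsT p k (w : braid_word p) :
  word_strands k setT w = word_set k w.
Proof. by elim: w k => //= a w IH k; rewrite setIT preimage_setT IH. Qed.

Lemma word_strands_z p k S (w : braid_word p) u : word_strands k S w u ->
  k%:R <= u.2 <= (k + size w)%:R.
Proof.
elim: w k S => [//|a w IH] k S /= [[j _ [t]]|/IH].
  rewrite /= in_itv /= => t01 <-; rewrite letter_strand_z addnS -natr1 natrD.
  by have := ler0n R (size w); lra.
by rewrite addSnnS -natr1; lra.
Qed.

Lemma word_strands_x p k S (w : braid_word p) u : word_strands k S w u ->
  u.1.1 <= p%:R.
Proof.
elim: w k S => [//|a w IH] k S /= [[j [jp _] [t]]|/IH //].
by rewrite /= in_itv /= => t01 <-; exact: letter_strand_x.
Qed.

Lemma word_strands_bottom p k S (w : braid_word p) u :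
  word_strands k S w u -> u.2 = k%:R ->
  exists2 j, S j & u = (j%:R, 0, k%:R).
Proof.
case: w => [//|a w] /= [[j [jp Sj] [t _ <-]]|/word_strands_z]; last first.
  by rewrite -natr1 => + E; rewrite E; lra.
rewrite letter_strand_z => E; have -> : t = 0 by lra.
by rewrite letter_strand0; exists j.
Qed.

Lemma word_strands_top p k S (w : braid_word p) u :
  word_strands k S w u -> u.2 = (k + size w)%:R ->
  exists2 j, S (word_perm w j) & u = (j%:R, 0, (k + size w)%:R).
Proof.
elim: w k S => [//|a w IH] k S /= [[j [jp Sj] [t]]|]; last first.
  by rewrite addnS -addSn; exact: IH.
rewrite /= in_itv /= => t01 <-; rewrite letter_strand_z.
(* A point of the first letter has height at most [k + 1], so it is at the top only if [t = 1] and
   no letters remain. *)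
rewrite addnS -natr1 natrD => E; have := ler0n R (size w) => w0.
have t1 : t = 1 by lra.
have {E} w0' : (size w)%:R = 0 :> R by lra.
rewrite t1 letter_strand1 w0' addr0 natr1; exists (swap a.1 j) => //.
have /eqP := w0'; rewrite pnatr_eq0 size_eq0 => /eqP ->.
by rewrite /word_perm /= swapK.
Qed.

Lemma word_strands_disjoint p k S T (w : braid_word p) :
  S `&` T = set0 -> word_strands k S w `&` word_strands k T w = set0.
Proof.
elim: w k S T => [|a w IH] k S T ST; first by rewrite set0I.
(* The first letter meets the rest of the word only at height [k + 1], at a top end of the former
   and a bottom end of the latter; undoing [swap] there gives a common starting position. *)
have glue S' T' u : S' `&` T' = set0 ->
    (\bigcup_(j in `I_p `&` S') (letter_strand a k j @` `[0, 1])) u ->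
    ~ word_strands k.+1 (swap a.1 @^-1` T') w u.
  move=> ST' [j [_ S'j] [t t01 <-]] wu.
  have := word_strands_z wu.
  move: t01; rewrite /= in_itv /= letter_strand_z => t01.
  rewrite -natr1 => /andP[kt _]; have t1 : t = 1 by lra.
  move: wu; rewrite t1 => /word_strands_bottom.
  rewrite letter_strand_z natr1 => /(_ erefl)[i T'i].
  rewrite letter_strand1 => -[] /eqP; rewrite eqr_nat => /eqP ij.
  have : (S' `&` T') j by split => //; rewrite -(swapK a.1 j) ij.
  by rewrite ST'.
rewrite -subset0 => u /= [[Su|Su] [Tu|Tu]].
- have [i [_ Si] [t /=]] := Su; rewrite in_itv /= => t01 ui.
  have [j [_ Tj] [t' _]] := Tu; rewrite -ui.
  move=> /esym/(letter_strand_inj t01) ij.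
  by have : (S `&` T) i by [split; rewrite // ij]; rewrite ST.
- exact: glue Su Tu.
- by apply: glue Tu Su; rewrite setIC.
- have /(IH k.+1) : swap a.1 @^-1` S `&` swap a.1 @^-1` T = set0.
    by rewrite -preimage_setI ST preimage_set0.
  by rewrite -subset0 => /(_ u); apply.
Qed.

(** * Closedness of strands and closing arcs *)

Lemma closed_arc (f : R -> R * R * R) (a b : R) : continuous f ->
  closed (f @` `[a, b]).
Proof.
move=> cf; apply: compact_closed; first exact: norm_hausdorff.
apply: continuous_compact; last exact: segment_compact.
exact: continuous_subspaceT.
Qed.

Lemma continuous_pair (X Y Z : topologicalType) (f : X -> Y) (g : X -> Z) :
  continuous f -> continuous g -> continuous (fun t => (f t, g t)).
Proof.
move=> cf cg t.
exact: (@cvg_pair _ _ _ _ (nbhs (f t)) (nbhs (g t)) _ _ _ _ _ (cf t) (cg t)).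
Qed.

Lemma continuous_triple (f g h : R -> R) :
  continuous f -> continuous g -> continuous h ->
  continuous (fun t => (f t, g t, h t)).
Proof.
move=> cf cg ch; exact: (continuous_pair (continuous_pair cf cg) ch).
Qed.

Lemma continuous_letter_strand p (a : 'I_p.-1 * bool) k j :
  continuous (letter_strand a k j : R -> _).
Proof.
have cadd (b : R) : continuous (fun t : R => b + t).
  by move=> t; apply: cvgD; [exact: cvg_cst|exact: cvg_id].
have csub (b : R) : continuous (fun t : R => b - t).
  by move=> t; apply: cvgB; [exact: cvg_cst|exact: cvg_id].
have cy (b : R) : continuous (fun t : R => b * (t * (1 - t))).
  move=> t; apply: cvgM; [exact: cvg_cst|apply: cvgM; [exact: cvg_id|]].
  exact: csub.
have c0 : continuous (fun _ : R => 0 : R) by move=> t; exact: cvg_cst.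
rewrite /letter_strand; case: eqP => _; last case: eqP => _.
- by apply: continuous_triple.
- by apply: continuous_triple => // t; apply: cvgN; exact: cy.
- by apply: continuous_triple => // t; exact: cvg_cst.
Qed.

Lemma closed_word_strands p k S (w : braid_word p) :
  closed (word_strands k S w).
Proof.
elim: w k S => [|a w IH] k S /=; first exact: closed0.
apply: closedU; last exact: IH.
apply: closed_bigcup => [|j _]; first exact: finite_setIl.
exact/closed_arc/continuous_letter_strand.
Qed.

Lemma closed_closing_arc p n j : closed (closing_arc p n j : set (R * R * R)).
Proof.
have cx (y z : R) : continuous (fun x : R => (x, y, z)).
  by apply: continuous_triple => t; [exact: cvg_id|exact: cvg_cst..].
have cz (x y : R) : continuous (fun z : R => (x, y, z)).
  by apply: continuous_triple => t; [exact: cvg_cst..|exact: cvg_id].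
by rewrite /closing_arc; do 4?apply: closedU; apply: closed_arc.
Qed.

(** * Closing arcs and the splitting of the closure *)

(** The offset [p - i] exceeds [p - j], so the arc of [i] runs outside that of [j]; linear
    arithmetic separates each of the 25 pairs of segments. *)
Lemma closing_arc_disjoint p n i j u : (i < p)%N -> (j < p)%N -> (i < j)%N ->
  closing_arc p n i u -> ~ closing_arc p n j u.
Proof.
move=> ip jp ij; rewrite /closing_arc.
rewrite !natrB ?(ltnW ip) ?(ltnW jp)//.
have n0 := ler0n R n.
move: ip jp ij; rewrite -!(ler_nat R) -!natr1 => ip jp ij.
move=> [[[[]|]|]|] [v] /=; rewrite in_itv /= => v1 <-;
  move=> [[[[]|]|]|] [v'] /=; rewrite in_itv /= => v2 [] *; lra.
Qed.

(** A closing arc touches the braid only at its two ends. At the bottom end the strand starts at [j]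
    itself; at the top end it starts at [word_perm w j], and the invariance of [S] applies. *)
Lemma word_strands_closing_arc p S (w : braid_word p) j u : (j < p)%N ->
    word_perm w @^-1` S = S ->
  word_strands 0 S w u -> closing_arc p (size w) j u -> S j.
Proof.
move=> jp wS wu; have wx := word_strands_x wu.
have := word_strands_z wu; rewrite add0n => wz.
have c0 : 0 < (p - j)%:R :> R by rewrite ltr0n subn_gt0.
have end_in i : u.1.1 = j%:R -> u.1.1 = i%:R -> i = j.
  by move=> -> /eqP; rewrite eqr_nat => /eqP.
(* Since [p - j > 0], the three outer segments miss the region [x <= p], [0 <= z <= size w] that
   contains the strands. *)
move=> [[[[]|]|]|] [v] /=; rewrite in_itv /= => v1 uE;
  move: (uE) wx wz end_in => <- /=; try lra.
- move=> _ wz end_in; have vE : v = (0 + size w)%:R by rewrite add0n; lra.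
  move: wu; rewrite -uE => /word_strands_top /(_ vE)[i wi [/(end_in _ erefl)]].
  by move=> <-; move: wi; rewrite -[in X in _ -> X]wS.
- move=> _ wz end_in; have vE : v = 0%:R by lra.
  move: wu; rewrite -uE => /word_strands_bottom /(_ vE)[i wi [ji]].
  by rewrite -(end_in _ erefl ji).
Qed.

(** For [S] invariant under [word_perm w] this is a sublink: the closing arcs lead its strands back
    to positions of [S]. *)
Definition closure_strands p S (w : braid_word p) : set (R * R * R) :=
  word_strands 0 S w `|` \bigcup_(j in `I_p `&` S) closing_arc p (size w) j.

Lemma closure_strandsU p S T (w : braid_word p) :
  closure_strands (S `|` T) w = closure_strands S w `|` closure_strands T w.
Proof.
by rewrite /closure_strands word_strandsU setIUr bigcup_setU setUACA.
Qed.

Lemma closure_strandsT p (w : braid_word p) :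
  closure_strands setT w = braid_closure w.
Proof. by rewrite /closure_strands word_strandsT setIT. Qed.

Lemma closed_closure_strands p S (w : braid_word p) :
  closed (closure_strands S w).
Proof.
apply: closedU; first exact: closed_word_strands.
apply: closed_bigcup => [|j _]; first exact: finite_setIl.
exact: closed_closing_arc.
Qed.

Lemma closure_strands_disjoint p S T (w : braid_word p) :
    word_perm w @^-1` S = S -> word_perm w @^-1` T = T ->
    S `&` T = set0 ->
  closure_strands S w `&` closure_strands T w = set0.
Proof.
move=> wS wT ST; have noST j : S j -> T j -> False.
  by move=> Sj Tj; have : (S `&` T) j by []; rewrite ST.
rewrite -subset0 => u /= [[Su|[i [ip Si] iu]] [Tu|[j [jp Tj] ju]]].
- by have := word_strands_disjoint 0 w ST; rewrite -subset0 => /(_ u); apply.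
- exact: noST (word_strands_closing_arc jp wS Su ju) Tj.
- exact: noST Si (word_strands_closing_arc ip wT Tu iu).
- case: (ltngtP i j) => ij.
  + exact: closing_arc_disjoint ip jp ij iu ju.
  + exact: closing_arc_disjoint jp ip ij ju iu.
  + by apply: (noST i) => //; rewrite ij.
Qed.

Lemma closure_strands_nonempty p S (w : braid_word p) j : (j < p)%N -> S j ->
  closure_strands S w !=set0.
Proof.
(* The witness is the start of the closing arc, which is present even when [w] is empty and has no
   strands. *)
move=> jp Sj; exists (j%:R, 0, (size w)%:R); right; exists j => //.
do 4!left; exists (size w)%:R => //=.
by rewrite in_itv /= lexx lerDl ler0n.
Qed.

(** * Disconnectedness of the closure *)

Lemma closedU_disconnected (X : topologicalType) (A B : set X) :
    closed A -> closed B -> A !=set0 -> B !=set0 -> A `&` B = set0 ->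
  ~ connected (A `|` B).
Proof.
move=> cA cB A0 [b Bb] AB /(_ A A0) conn.
have : A = A `|` B.
  apply: conn.
  (* On the union, [A] is the trace of the open complement of [B] and also of the closed set [A], so
     connectedness would make it everything. *)
  - exists (~` B); first exact: closed_openC.
    rewrite setIUl setICr setU0; apply/esym/setIidPl.
    exact/disjoints_subset.
  - by exists A => //; rewrite setUK.
move=> AE; have : (A `&` B) b by split => //; rewrite AE; right.
by rewrite AB.
Qed.

Lemma braid_closure_disconnected p S (w : braid_word p) i j :
    (i < p)%N -> (j < p)%N -> S i -> ~ S j -> word_perm w @^-1` S = S ->
  ~ connected (braid_closure w : set (R * R * R)).
Proof.
move=> ip jp Si Sj wS; rewrite -closure_strandsT -(setUv S) closure_strandsU.
apply: closedU_disconnected.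
- exact: closed_closure_strands.
- exact: closed_closure_strands.
- exact: closure_strands_nonempty ip Si.
- exact: closure_strands_nonempty jp Sj.
- apply: closure_strands_disjoint; [exact: wS| |exact: setICr].
  by rewrite -preimage_setC wS.
Qed.

(** The components cover [L], so a sole component is [L] itself. *)
Lemma is_knot_connected (L : set (R * R * R)) : is_knot L -> connected L.
Proof.
move=> [C LC]; suff -> : L = C.
  have : components L C by rewrite LC.
  by move=> [x _ <-]; exact: component_connected.
by rewrite -(connected_component_cover L) -/(components L) LC bigcup_set1.
Qed.

End Strands.

(** * Residue classes modulo the gcd *)

Theorem corollary1p3 (R : realType) (p r : nat) (q s : int)
    (hr : (0 < r)%N) (hrp : (r <= p)%N)
    (hknot : is_knot (twisted_torus_link R p q r s)) :
  gcdz (gcdz (gcdz p%:Z q) r%:Z) s = 1.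
Proof.
rewrite /gcdz !absz_nat; set d := gcdn _ _; congr Posz.
have /and4P[dp dq dr ds] :
    [&& d %| p, d %| `|q|, d %| r & d %| `|s| ]%N.
  by rewrite !andbA -!dvdn_gcd.
have d0 : (0 < d)%N by rewrite (dvdn_gt0 _ dr).
apply/eqP; apply: contraPT (is_knot_connected hknot) => d1.
have {}d1 : (1 < d)%N by rewrite ltn_neqAle eq_sym d1.
(* Position [0] is in the residue class of [0] and [1] is not, as [d > 1]; both positions exist
   because [d <= p]. *)
apply: (@braid_closure_disconnected _ _ [set j | j = 0 %[mod d]] _ 0 1) => //=.
- exact: leq_trans hr hrp.
- by apply: leq_trans d1 _; apply: dvdn_leq => //; exact: leq_trans hr hrp.
- by rewrite mod0n modn_small.
- by apply/seteqP; split => j /=; rewrite word_perm_twisted_torus.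
Qed.
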